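(* Let $d\ge 1$ and $n\ge 0$ be integers and let $N=\dim(\mathbb{P}_n)=\binom{n+d}{d}$. Let $\mu$ be a finite measure with support $\Omega\subseteq\mathbb{R}^d$ such that all polynomials in $\mathbb{P}_n$ are $\mu$-integrable, and let $\lambda$ be a finite measure with $\mathbb{P}_n$-determining support $B\subseteq\mathbb{R}^d$ such that all polynomials in $\mathbb{P}_{2n}$ are $\lambda$-integrable. Let $\{p_j\}_{1\le j\le N}$ be a $\lambda$-orthonormal basis of $\mathbb{P}_n$, and let $(X,\mathbf{u})=\{(x_i,u_i):1\le i\le M\}$, $M\ge N$, be the nodes $X=\{x_i\}\subseteq B$ and positive weights $u_i>0$ of a quadrature formula for $\lambda$ that is exact in $\mathbb{P}_{2n}$, i.e. $$\int_B p(x)\,d\lambda=\sum_{i=1}^M u_i\,p(x_i)\qquad\text{for all }p\in\mathbb{P}_{2n}.$$ Let $V=(v_{ij})\in\mathbb{R}^{M\times N}$ with $v_{ij}=p_j(x_i)$, let $D=\mathrm{diag}(u_1,\dots,u_M)$, and let $\mathbf{m}=(m_j)\in\mathbb{R}^N$ be the vector of moments $m_j=\int_\Omega p_j(x)\,d\mu$, $1\le j\le N$. Define $\mathbf{w}=(w_i)\in\mathbb{R}^M$ by $$\mathbf{w}=DV\mathbf{m}.$$ Then the discrete signed measure $(X,\mathbf{w})=\{(x_i,w_i):1\le i\le M\}$ supported on $X\subseteq B$ gives a quadrature formula for $\mu$ that is exact in $\mathbb{P}_n$, i.e. $$\int_\Omega p(x)\,d\mu=\sum_{i=1}^M w_i\,p(x_i)\qquad\text{for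 all }p\in\mathbb{P}_n,$$ and its weights satisfy $$\|\mathbf{w}\|_1\le\sqrt{\lambda(B)}\;\|\mathbf{m}\|_2 .$$
   Context: $\mathbb{P}_k$ denotes the space of real polynomials in $d$ variables of total degree at most $k$. Measures are (positive) Borel measures on $\mathbb{R}^d$; the support of a measure is its closed support. A set $B\subseteq\mathbb{R}^d$ is $\mathbb{P}_n$-determining if every polynomial in $\mathbb{P}_n$ vanishing on $B$ vanishes everywhere in $\mathbb{R}^d$. A basis $\{p_j\}$ of $\mathbb{P}_n$ is $\lambda$-orthonormal if $\int_B p_h p_k\,d\lambda=\delta_{hk}$ for all $h,k$. $\|\cdot\|_1$ and $\|\cdot\|_2$ are the usual $\ell^1$ and Euclidean norms of vectors. *)

(* Defs.v *)
From HB Require Import structures.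
From mathcomp Require Import all_boot all_order all_algebra.
From mathcomp Require Import all_classical all_reals all_analysis.
(* The notations of mpoly and of mathcomp-analysis are incompatible. *)
From mathcomp Require Import -(notations) mpoly.

Set Implicit Arguments.
Unset Strict Implicit.
Unset Printing Implicit Defensive.

Import Order.TTheory GRing.Theory Num.Theory.
Import numFieldNormedType.Exports.

Local Open Scope classical_set_scope.
Local Open Scope ring_scope.

(* R^d with its Borel sigma-algebra; the topology on row vectors is the usual
   one (that of the sup norm). *)
Definition borel_space (R : realType) (d : nat) :=
  g_sigma_algebraType (@open 'rV[R]_d).

Definition borel_measure (R : realType) (d : nat) :=
  {finite_measure set (borel_space R d) -> \bar R}.

(* Complement of the union of all the open null sets. *)
Definition msupport (R : realType) (d : nat) (mu : borel_measure R d) :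
    set 'rV[R]_d :=
  [set x | forall U : set 'rV[R]_d, open U -> U x -> (0 < mu U)%E].

Definition peval (R : realType) (d : nat) (p : mpoly d R) (x : 'rV[R]_d) : R :=
  meval (fun i => x ord0 i) p.

(* P_k; [mmeasure mdeg p] is 1 + the total degree of [p], and 0 if [p = 0]. *)
Definition in_P (R : realType) (d k : nat) (p : mpoly d R) : Prop :=
  (mmeasure mdeg p <= k.+1)%N.

Definition determining (R : realType) (d k : nat) (B : set 'rV[R]_d) : Prop :=
  forall p : mpoly d R, in_P k p -> (forall x, B x -> peval p x = 0) ->
    forall x, peval p x = 0.

Definition P_integrable (R : realType) (d k : nat) (mu : borel_measure R d) :
    Prop :=
  forall p : mpoly d R, in_P k p ->
    mu.-integrable [set: borel_space R d] (fun x => (peval p x)%:E).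

Definition is_basis_P (R : realType) (d k N : nat) (p : 'I_N -> mpoly d R) :
    Prop :=
  (forall j, in_P k (p j)) /\
  (forall q : mpoly d R, in_P k q ->
    exists! c : {ffun 'I_N -> R}, q = \sum_(j < N) c j *: p j).

Definition orthonormal_on (R : realType) (d N : nat) (mu : borel_measure R d)
    (B : set 'rV[R]_d) (p : 'I_N -> mpoly d R) : Prop :=
  forall h k : 'I_N,
    (\int[mu]_(x in B) (peval (p h) x * peval (p k) x)%:E = (h == k)%:R%:E)%E.

Definition exact_quadrature (R : realType) (d k M : nat)
    (mu : borel_measure R d) (A : set 'rV[R]_d)
    (x : 'I_M -> 'rV[R]_d) (w : 'I_M -> R) : Prop :=
  forall p : mpoly d R, in_P k p ->
    (\int[mu]_(y in A) (peval p y)%:E = (\sum_(i < M) w i * peval p (x i))%:E)%E.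

Definition moments (R : realType) (d N : nat) (mu : borel_measure R d)
    (A : set 'rV[R]_d) (p : 'I_N -> mpoly d R) : 'cV[R]_N :=
  \col_j Rintegral mu A (fun y => peval (p j) y).

Definition norm1 (R : realType) (m : nat) (v : 'cV[R]_m) : R :=
  \sum_(i < m) `|v i ord0|.

Definition norm2 (R : realType) (m : nat) (v : 'cV[R]_m) : R :=
  Num.sqrt (\sum_(i < m) v i ord0 ^+ 2).

(* Main.v *)
(* Orthonormality and exactness in P_{2n} give V^T D V = 1, so for q with
   coordinate vector c in the basis, sum_i w_i q(x_i) = (V c)^T D V m = c^T m,
   which is the integral of q.  Cauchy-Schwarz for the weights u bounds |w|_1 by
   sqrt (sum_i u_i) * sqrt ((V m)^T D (V m)) = sqrt (lambda B) * |m|_2. *)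
Require Import Defs.
From HB Require Import structures.
From mathcomp Require Import all_boot all_order all_algebra.
From mathcomp Require Import all_classical all_reals all_analysis.
From mathcomp Require Import -(notations) mpoly.
From mathcomp Require Import ring.

Set Implicit Arguments.
Unset Strict Implicit.
Unset Printing Implicit Defensive.

Import Order.TTheory GRing.Theory Num.Theory.
Import numFieldNormedType.Exports.

Local Open Scope classical_set_scope.
Local Open Scope ring_scope.

Lemma weighted_cauchy_schwarz (R : realFieldType) (I : finType) (u y : I -> R) :
  (forall i, 0 <= u i) ->
  (\sum_i u i * y i) ^+ 2 <= (\sum_i u i) * \sum_i u i * y i ^+ 2.
Proof.
move=> u_ge0; set S := \sum_i u i * y i; set L := \sum_i u i; set Q := \sum_i _.
have L_ge0 : 0 <= L by exact: sumr_ge0.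
(* Zero total weight forces every weight to vanish; otherwise [L] is positive and can be cancelled
   at the end. *)
have [L0|L_neq0] := eqVneq L 0.
  have u0 i : u i = 0 by exact: (psumr_eq0P _ L0).
  suff -> : S = 0 by rewrite L0 mul0r expr0n.
  by apply: big1 => i _; rewrite u0 mul0r.
(* the weighted variance of [y], up to the factor [L ^+ 2] *)
have : 0 <= \sum_i u i * (L * y i - S) ^+ 2.
  by apply: sumr_ge0 => i _; rewrite mulr_ge0 ?sqr_ge0.
have -> : \sum_i u i * (L * y i - S) ^+ 2 = L * (L * Q - S ^+ 2).
  transitivity (L ^+ 2 * Q - 2 * L * S * S + S ^+ 2 * L); last by ring.
  rewrite [L ^+ 2 * Q]mulr_sumr [2 * L * S * S]mulr_sumr [S ^+ 2 * L]mulr_sumr.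
  by rewrite -sumrB -big_split /=; apply: eq_bigr => i _; ring.
by rewrite pmulr_rge0 ?subr_ge0 // lt_neqAle eq_sym L_neq0.
Qed.

(** The complement is open: an open null set around one of its points excludes all its other points
    from the support too. *)
Lemma measurable_msupport (R : realType) (d : nat) (mu : borel_measure R d) :
  measurable (msupport mu : set (borel_space R d)).
Proof.
rewrite -[msupport mu]setCK; apply: measurableC; apply: sub_sigma_algebra.
rewrite openE => x /existsNP[U] /not_implyP[oU] /not_implyP[Ux nU].
by apply: filterS (open_nbhs_nbhs (conj oU Ux)) => y Uy /(_ U oU Uy).
Qed.

Lemma in_P1 (R : realType) (d k : nat) : in_P k (1 : mpoly d R).
Proof. by rewrite /in_P msize1. Qed.

Lemma in_PM (R : realType) (d k : nat) (p q : mpoly d R) :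
  in_P k p -> in_P k q -> in_P (2 * k) (p * q).
Proof.
rewrite /in_P => hp hq.
have [->|p0] := eqVneq p 0; first by rewrite mul0r msize0.
have [->|q0] := eqVneq q 0; first by rewrite mulr0 msize0.
(* Sizes are degrees plus one, so the size of a product of nonzero polynomials is the sum of the
   sizes minus one. *)
rewrite msizeM // -ltnS prednK; last by rewrite addn_gt0 lt0n msize_poly_eq0 p0.
by rewrite mul2n -addnn -addSn -addnS leq_add.
Qed.

Lemma pevalM (R : realType) (d : nat) (p q : mpoly d R) (x : 'rV[R]_d) :
  peval (p * q) x = peval p x * peval q x.
Proof. exact: mevalM. Qed.

Lemma peval1 (R : realType) (d : nat) (x : 'rV[R]_d) :
  peval (1 : mpoly d R) x = 1.
Proof. exact: meval1. Qed.

Lemma peval_lincomb (R : realType) (d N : nat) (c : 'I_N -> R)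
    (p : 'I_N -> mpoly d R) (x : 'rV[R]_d) :
  peval (\sum_j c j *: p j) x = \sum_j c j * peval (p j) x.
Proof. by rewrite /peval raddf_sum; apply: eq_bigr => j _; exact: mevalZ. Qed.

Lemma integral_lincomb (R : realType) (d n N : nat) (mu : borel_measure R d)
    (A : set (borel_space R d)) (p : 'I_N -> mpoly d R) (c : 'I_N -> R) :
  measurable A -> P_integrable n mu -> (forall j, in_P n (p j)) ->
  (\int[mu]_(x in A) (peval (\sum_j c j *: p j) x)%:E =
   (\sum_j c j * moments mu A p j ord0)%:E)%E.
Proof.
move=> mA hmu hp.
have intp j : mu.-integrable A (fun x => (peval (p j) x)%:E).
  by apply: integrableS (hmu _ (hp j)).
under eq_integral => x _.
  rewrite peval_lincomb -sumEFin; under eq_bigr do rewrite EFinM.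
  over.
rewrite integral_sum //; last by move=> j; exact: integrableZl.
rewrite -sumEFin; apply: eq_bigr => j _.
rewrite integralZl // mxE EFinM; congr (_ * _)%E.
(* Integrability makes the integral finite, so the [fine] hidden in [moments] loses nothing. *)
by rewrite /Rintegral fineK // integrable_fin_num.
Qed.

(** Entry (h, k) of the product is the quadrature sum of [p h * p k], which has degree at most 2n
    and is therefore integrated exactly. *)
Lemma quadrature_gram (R : realType) (d n N M : nat) (lambda : borel_measure R d)
    (B : set 'rV[R]_d) (p : 'I_N -> mpoly d R) (x : 'I_M -> 'rV[R]_d)
    (u : 'I_M -> R) :
  (forall j, in_P n (p j)) -> orthonormal_on lambda B p ->
  exact_quadrature (2 * n) lambda B x u ->
  let V := \matrix_(i < M, j < N) peval (p j) (x i) in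
  V^T *m diag_mx (\row_i u i) *m V = 1%:M.
Proof.
move=> hp horth hquad V; apply/matrixP => h k; rewrite !mxE.
have := hquad _ (in_PM (hp h) (hp k)).
under eq_integral => y _ do rewrite pevalM.
rewrite horth => -[->]; apply: eq_bigr => i _.
by rewrite mul_mx_diag !mxE pevalM mulrA [u i * _]mulrC.
Qed.

(** Exactness is applied to the constant polynomial 1. *)
Lemma quadrature_mass (R : realType) (d k M : nat) (lambda : borel_measure R d)
    (B : set (borel_space R d)) (x : 'I_M -> 'rV[R]_d) (u : 'I_M -> R) :
  measurable B -> exact_quadrature k lambda B x u ->
  fine (lambda B) = \sum_i u i.
Proof.
move=> mB /(_ _ (in_P1 _ _ _)).
under eq_integral => y _ do rewrite peval1.
rewrite (integral_cst lambda mB 1) mul1e => ->; apply: eq_bigr => i _.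
by rewrite peval1 mulr1.
Qed.

Theorem theorem2p1 (R : realType) (d n N M : nat)
  (hd : (1 <= d)%N) (hN : N = 'C(n + d, d))
  (mu : borel_measure R d) (Omega : set 'rV[R]_d)
  (hOmega : Omega = msupport mu)
  (hmu : P_integrable n mu)
  (lambda : borel_measure R d) (B : set 'rV[R]_d)
  (hB : B = msupport lambda)
  (hdet : determining n B)
  (hlambda : P_integrable (2 * n) lambda)
  (p : 'I_N -> mpoly d R)
  (hbasis : is_basis_P n p)
  (horth : orthonormal_on lambda B p)
  (hM : (N <= M)%N)
  (x : 'I_M -> 'rV[R]_d) (u : 'I_M -> R)
  (hx : forall i, B (x i)) (hu : forall i, 0 < u i)
  (hquad : exact_quadrature (2 * n) lambda B x u)
  (V : 'M[R]_(M, N)) (hV : V = \matrix_(i < M, j < N) peval (p j) (x i))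
  (D : 'M[R]_M) (hD : D = diag_mx (\row_(i < M) u i))
  (m : 'cV[R]_N) (hm : m = moments mu Omega p)
  (w : 'cV[R]_M) (hw : w = D *m V *m m) :
  exact_quadrature n mu Omega x (fun i => w i ord0) /\
  norm1 w <= Num.sqrt (fine (lambda B)) * norm2 m.
Proof.
have [hp hspan] := hbasis.
have gram := quadrature_gram hp horth hquad.
rewrite /= -hV -hD in gram.
have wE i : w i ord0 = u i * (V *m m) i ord0.
  by rewrite hw -mulmxA hD mul_diag_mx !mxE.
split.
  move=> q /hspan[c [-> _]].
  rewrite (integral_lincomb c _ hmu hp); last first.
    by rewrite hOmega; exact: measurable_msupport.
  rewrite -hm; congr EFin.
  (* The identity, written as the Gram matrix, is inserted between the coordinates and the moments;
     regrouping then exposes the nodal values of q against [w]. *)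
  transitivity (((\row_j c j) *m (V^T *m D *m V) *m m) ord0 ord0).
    by rewrite gram mulmx1 mxE; apply: eq_bigr => j _; rewrite mxE.
  rewrite -!mulmxA [D *m _]mulmxA -hw mulmxA mxE; apply: eq_bigr => i _.
  rewrite mulrC peval_lincomb mxE; congr (_ * _).
  by apply: eq_bigr => j _; rewrite hV !mxE.
have mB : measurable (B : set (borel_space R d)).
  by rewrite hB; exact: measurable_msupport.
(* The absolute values match the later use of Cauchy-Schwarz with y_i = |(V m)_i|; they disappear
   under the square. *)
have normE : \sum_i u i * `|(V *m m) i ord0| ^+ 2 = \sum_j m j ord0 ^+ 2.
  transitivity ((m^T *m (V^T *m D *m V) *m m) ord0 ord0).
    rewrite -!mulmxA [D *m _]mulmxA -hw mulmxA -trmx_mul mxE.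
    apply: eq_bigr => i _.
    by rewrite wE real_normK ?num_real // [in RHS]mxE; ring.
  by rewrite gram mulmx1 mxE; apply: eq_bigr => j _; rewrite mxE expr2.
have u_ge0 i : 0 <= u i by exact: ltW.
have mass := quadrature_mass mB hquad.
have norm1E : norm1 w = \sum_i u i * `|(V *m m) i ord0|.
  by apply: eq_bigr => i _; rewrite wE normrM ger0_norm.
(* Both sides become square roots, which reduces the bound to the squared Cauchy-Schwarz
   inequality. *)
rewrite /norm2 -sqrtrM; last by rewrite mass sumr_ge0.
rewrite -[norm1 w]ger0_norm; last by apply: sumr_ge0 => i _; exact: normr_ge0.
rewrite -sqrtr_sqr ler_wsqrtr // mass norm1E -normE.
exact: weighted_cauchy_schwarz.
Qed.
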